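(* Let $\alpha,\beta\in(1,2)$ and let $c(x,y,t)\ge0$, $d(x,y,t)\ge 0$ be variable coefficients. Consider the two-dimensional Riesz fractional diffusion equation $$\frac{\partial u}{\partial t}=c(x,y,t)\frac{\partial^\alpha u}{\partial|x|^\alpha}+d(x,y,t)\frac{\partial^\beta u}{\partial|y|^\beta}+f(x,y,t)$$ on $(x_L,x_R)\times(y_L,y_R)\times(0,T]$ with homogeneous Dirichlet boundary conditions, and, with the matrices $A_x=A_{2D,\Delta x}^{k+1/2}$, $A_y=A_{2D,\Delta y}^{k+1/2}$ specified in the context, its factored Crank–Nicolson discretization $$(I-A_x)(I-A_y)U^{k+1}=(I+A_x)(I+A_y)U^{k}+\Delta t\,F^{k+1/2},$$ solved by either of the following alternating-direction schemes with intermediate solution $U^*$: (D-AD) $\;(I-A_x)U^{*}=(I+A_x+2A_y)U^{k}+\Delta t\,F^{k+1/2}$, $\quad (I-A_y)U^{k+1}=U^{*}-A_yU^{k}$; (PR-AD) $\;(I-A_x)U^{*}=(I+A_y)U^{k}+\frac{\Delta t}{2}F^{k+1/2}$, $\quad (I-A_y)U^{k+1}=(I+A_x)U^{*}+\frac{\Delta t}{2}F^{k+1/2}$. If the matrices $A_{2D,\Delta x}^{k+1/2}$ and $A_{2D,\Delta y}^{k+1/2}$ commute, then both the D-AD scheme and the PR-AD scheme are unconditionally stable.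
   Context: Grid: $\Delta x=(x_R-x_L)/N_x$, $\Delta y=(y_R-y_L)/N_y$, $\Delta t=T/N_t$, $x_i=x_L+i\Delta x$, $y_j=y_L+j\Delta y$, $t_k=k\Delta t$, $t_{k+1/2}=(t_k+t_{k+1})/2$; $c_{i,j}^{k+1/2}=c(x_i,y_j,t_{k+1/2})$, similarly $d_{i,j}^{k+1/2}$. The vectors $U^k=(u_{i,j}^k)$ (approximations of $u(x_i,y_j,t_k)$) and $U^*=(u^*_{i,j})$ are indexed by interior points $1\le i\le N_x-1$, $1\le j\le N_y-1$; $F^{k+1/2}$ contains the source values $f(x_i,y_j,t_{k+1/2})$ (and absorbs the Dirichlet boundary data). The Riesz derivative of order $\nu\in(1,2)$ is $\frac{\partial^\nu u}{\partial|x|^\nu}=-\kappa_\nu\left({}_{x_L}D_x^\nu+{}_xD_{x_R}^\nu\right)u$, where $\kappa_\nu=\frac{1}{2\cos(\nu\pi/2)}$ and the two operators are the left and right Riemann–Liouville derivatives; analogously in $y$. For $\nu\in(1,2)$ define $g_0^\nu=1$, $g_1^\nu=-4+2^{3-\nu}$, $g_2^\nu=6-2^{5-\nu}+3^{3-\nu}$, and for $m\ge 3$ $$g_m^\nu=(m+1)^{3-\nu}-4m^{3-\nu}+6(m-1)^{3-\nu}-4(m-2)^{3-\nu}+(m-3)^{3-\nu}.$$ Let $\widetilde g_{i,i}^\nu=2g_1^\nu$; $\widetilde g_{i,m}^\nu=g_0^\nu+g_2^\nu$ if $|i-m|=1$; and $\widetilde g_{i,m}^\nu=g_{|i-m|+1}^\nu$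 if $|i-m|\ge 2$. $A_x$ and $A_y$ are the square matrices of size $(N_x-1)(N_y-1)$ acting on interior grid vectors $U=(u_{i,j})$ by $$(A_xU)_{i,j}=\frac{-\Delta t\,\kappa_\alpha c_{i,j}^{k+1/2}}{2\Gamma(4-\alpha)\Delta x^\alpha}\sum_{m=1}^{N_x-1}\widetilde g_{i,m}^\alpha u_{m,j},\qquad (A_yU)_{i,j}=\frac{-\Delta t\,\kappa_\beta d_{i,j}^{k+1/2}}{2\Gamma(4-\beta)\Delta y^\beta}\sum_{m=1}^{N_y-1}\widetilde g_{j,m}^\beta u_{i,m}.$$ Sense of stability: ''unconditionally'' means with no restriction on the step sizes. Errors propagate by $(I-A_x)(I-A_y)E^{k+1}=(I+A_x)(I+A_y)E^k$, and stability is understood through the criterion that the spectral radii of $(I-A_x)^{-1}(I+A_x)$ and of $(I-A_y)^{-1}(I+A_y)$ are both less than $1$, so that the powers of each of these two matrices converge to the zero matrix.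
   Formalization: Spectral radii < 1 and powers tending to zero are proved when c, d > 0 at all interior grid points at t_{k+1/2}; if c or d vanishes at one, a radius is at least 1 (c=0 gives the identity). For c, d ≥ 0 only radii ≤ 1, bounded powers and bounded errors are proved. *)

(* Defs.v *)
From HB Require Import structures.
From mathcomp Require Import all_boot all_order all_algebra.
From mathcomp Require Import complex.
From mathcomp Require Import all_classical all_reals all_analysis.

Set Implicit Arguments.
Unset Strict Implicit.
Unset Printing Implicit Defensive.

Import Order.TTheory GRing.Theory Num.Theory numFieldNormedType.Exports.

Local Open Scope classical_set_scope.
Local Open Scope ring_scope.

Definition Gamma (R : realType) (z : R) : R :=
  \int[@lebesgue_measure R]_(t in `]0, +oo[) (t `^ (z - 1) * expR (- t)).

Definition kappa (R : realType) (nu : R) : R := (2 * cos (nu * pi / 2))^-1.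

(* At m = 3 the last term is 0 `^ (3 - nu), which is 0 since nu != 3. *)
Definition g (R : realType) (nu : R) (m : nat) : R :=
  match m with
  | 0 => 1
  | 1 => - 4 + 2 `^ (3 - nu)
  | 2 => 6 - 2 `^ (5 - nu) + 3 `^ (3 - nu)
  | _ => m.+1%:R `^ (3 - nu) - 4 * m%:R `^ (3 - nu)
         + 6 * (m - 1)%:R `^ (3 - nu) - 4 * (m - 2)%:R `^ (3 - nu)
         + (m - 3)%:R `^ (3 - nu)
  end.

Definition gtilde (R : realType) (nu : R) (i m : nat) : R :=
  let dist := ((i - m) + (m - i))%N in
  match dist with
  | 0 => 2 * g nu 1
  | 1 => g nu 0 + g nu 2
  | _ => g nu dist.+1
  end.

Record mesh (R : realType) := Mesh {
  xL : R; xR : R; yL : R; yR : R; Tmax : R;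
  Nx : nat; Ny : nat; Nt : nat
}.

Section Mesh.
Variables (R : realType) (G : mesh R).

Definition dx : R := (xR G - xL G) / (Nx G)%:R.
Definition dy : R := (yR G - yL G) / (Ny G)%:R.
Definition dt : R := Tmax G / (Nt G)%:R.
Definition xpt (i : nat) : R := xL G + i%:R * dx.
Definition ypt (j : nat) : R := yL G + j%:R * dy.
Definition tpt (k : nat) : R := k%:R * dt.
Definition thalf (k : nat) : R := (tpt k + tpt k.+1) / 2.

(* Interior nodes are numbered from 1 in the mathematics and from 0 here: the
   pair (i, j) : 'I_(Nx - 1) * 'I_(Ny - 1) stands for (x_{i+1}, y_{j+1}). *)
Definition at_node (c : R -> R -> R -> R) (k : nat)
    (i : 'I_(Nx G - 1)) (j : 'I_(Ny G - 1)) : R :=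
  c (xpt i.+1) (ypt j.+1) (thalf k).

Definition gridfun := 'M[R]_(Nx G - 1, Ny G - 1).
Definition gsize : nat := ((Nx G - 1) * (Ny G - 1))%N.
Definition gridvec (U : gridfun) : 'cV[R]_gsize := (mxvec U)^T.

Definition opx (alpha : R) (c : R -> R -> R -> R) (k : nat) (U : gridfun)
    : gridfun :=
  \matrix_(i, j)
    (- (dt * kappa alpha * at_node c k i j)
       / (2 * Gamma (4 - alpha) * dx `^ alpha)
     * \sum_(m < Nx G - 1) gtilde alpha i m * U m j).

Definition opy (beta : R) (d : R -> R -> R -> R) (k : nat) (U : gridfun)
    : gridfun :=
  \matrix_(i, j)
    (- (dt * kappa beta * at_node d k i j)
       / (2 * Gamma (4 - beta) * dy `^ beta)
     * \sum_(m < Ny G - 1) gtilde beta j m * U i m).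

(* lin_mx acts on rows; the transpose acts on columns (see Ax_gridvec). *)
Definition Ax (alpha : R) (c : R -> R -> R -> R) (k : nat) : 'M[R]_gsize :=
  (lin_mx (opx alpha c k))^T.

Definition Ay (beta : R) (d : R -> R -> R -> R) (k : nat) : 'M[R]_gsize :=
  (lin_mx (opy beta d k))^T.

Lemma opx_linear alpha c k : linear (opx alpha c k).
Proof.
move=> a U V; apply/matrixP => i j; rewrite !mxE mulrCA -mulrDr; congr (_ * _).
rewrite mulr_sumr -big_split; apply: eq_bigr => m _.
by rewrite !mxE mulrDr mulrCA.
Qed.

Lemma opy_linear beta d k : linear (opy beta d k).
Proof.
move=> a U V; apply/matrixP => i j; rewrite !mxE mulrCA -mulrDr; congr (_ * _).
rewrite mulr_sumr -big_split; apply: eq_bigr => m _.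
by rewrite !mxE mulrDr mulrCA.
Qed.

Lemma Ax_gridvec alpha c k U :
  Ax alpha c k *m gridvec U = gridvec (opx alpha c k U).
Proof.
pose L := GRing.isLinear.Build _ _ _ _ _ (opx_linear alpha c k).
pose f : {linear gridfun -> gridfun} := HB.pack (opx alpha c k) L.
by rewrite /Ax /gridvec -trmx_mul (mul_vec_lin f).
Qed.

Lemma Ay_gridvec beta d k U :
  Ay beta d k *m gridvec U = gridvec (opy beta d k U).
Proof.
pose L := GRing.isLinear.Build _ _ _ _ _ (opy_linear beta d k).
pose f : {linear gridfun -> gridfun} := HB.pack (opy beta d k) L.
by rewrite /Ay /gridvec -trmx_mul (mul_vec_lin f).
Qed.

End Mesh.

Arguments at_node {R} G c k i j.

Section Stability.
Variables (R : realType) (n : nat).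
Implicit Types (A B M : 'M[R]_n) (F : 'cV[R]_n).

(* Largest modulus of a complex eigenvalue; it is 0 when n = 0. *)
Definition spectral_radius M : R :=
  sup [set ComplexField.Normc.normc z | z in
        [set z : R[i] | eigenvalue (map_mx (real_complex R) M) z]].

Definition cayley A : 'M[R]_n := invmx (1%:M - A) *m (1%:M + A).

(* One step of a scheme: step F U U' relates the source F and the current
   level U to the next level U'. *)
Definition scheme := 'cV[R]_n -> 'cV[R]_n -> 'cV[R]_n -> Prop.

Definition D_AD A B (tau : R) : scheme := fun F U U' =>
  exists Us : 'cV[R]_n,
    (1%:M - A) *m Us = (1%:M + A + B *+ 2) *m U + tau *: F /\
    (1%:M - B) *m U' = Us - B *m U.

Definition PR_AD A B (tau : R) : scheme := fun F U U' =>
  exists Us : 'cV[R]_n,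
    (1%:M - A) *m Us = (1%:M + B) *m U + (tau / 2) *: F /\
    (1%:M - B) *m U' = (1%:M + A) *m Us + (tau / 2) *: F.

Definition well_posed (step : scheme) : Prop :=
  forall F (U : 'cV[R]_n), exists! U', step F U U'.

Definition propagates_errors A B (step : scheme) : Prop :=
  forall F (U U' V V' : 'cV[R]_n), step F U U' -> step F V V' ->
    (1%:M - A) *m (1%:M - B) *m (U' - V') =
    (1%:M + A) *m (1%:M + B) *m (U - V).

(* The invertibility of 1 - A is required because invmx is the identity on
   singular matrices. *)
Definition cayley_contractive A : Prop :=
  [/\ 1%:M - A \in unitmx,
      spectral_radius (cayley A) < 1 &
      (fun p : nat => cayley A ^+ p) @ \oo --> (0 : 'M[R]_n)].

Definition cayley_bounded A : Prop :=
  [/\ 1%:M - A \in unitmx,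
      spectral_radius (cayley A) <= 1 &
      exists K : R, forall p : nat, `|cayley A ^+ p| <= K].

(* Two runs of the scheme with the same sources; the matrices of the scheme are
   frozen at one time level, as in the spectral criterion. *)
Definition two_runs (step : scheme) (U V : nat -> 'cV[R]_n) : Prop :=
  exists F : nat -> 'cV[R]_n,
    forall p, step (F p) (U p) (U p.+1) /\ step (F p) (V p) (V p.+1).

(* The error after p steps is cayley A ^+ p *m cayley B ^+ p applied to the
   initial error when A and B commute. *)
Definition stable A B (step : scheme) : Prop :=
  [/\ well_posed step,
      propagates_errors A B step,
      cayley_contractive A /\ cayley_contractive B &
      forall U V, two_runs step U V ->
        (fun p => U p - V p) @ \oo --> (0 : 'cV[R]_n)].

(* When a coefficient vanishes at a node, A has the eigenvalue 0 and cayley A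
   the eigenvalue 1, so no strict contraction is possible: errors stay bounded
   but need not decay. *)
Definition weakly_stable A B (step : scheme) : Prop :=
  [/\ well_posed step,
      propagates_errors A B step,
      cayley_bounded A /\ cayley_bounded B &
      exists K : R, forall U V, two_runs step U V ->
        forall p, `|U p - V p| <= K * `|U 0%N - V 0%N|].

End Stability.

(* Main.v *)
(* Let S be the matrix with entries -gtilde, extended to the grid by acting on
   one coordinate.  Then A = - D S (and likewise B) with D a nonnegative diagonal
   matrix, since kappa is negative, and S is symmetric with nonpositive
   off-diagonal entries and positive row sums: off the diagonal the weights are
   fourth differences of x ^ (3 - nu), which are nonnegative, and the partial
   sums of the g_m are third differences, which are negative.  Hence
   q(v) = v^T S v is positive definite, and if (1 - A) w = (1 + A) v then
     q(v) - q(w) = sum_i D_i (S (v + w))_i ^ 2 >= 0,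
   so the Cayley transform of A contracts q, by a factor < 1 when D > 0.  Its
   powers are thus bounded, resp. geometrically small, which also bounds the
   spectral radius.  As A and B commute, the error after p steps is
   cayley A ^ p * cayley B ^ p applied to the initial error. *)
Require Import Defs.
From mathcomp Require Import all_boot all_order all_algebra.
From mathcomp Require Import complex zify ring lra.
From mathcomp Require Import all_classical all_reals all_analysis.
From mathcomp Require Import measurable_realfun.

Set Implicit Arguments.
Unset Strict Implicit.
Unset Printing Implicit Defensive.

Import Order.TTheory GRing.Theory Num.Theory.
Import numFieldNormedType.Exports.
Local Open Scope classical_set_scope.
Local Open Scope ring_scope.

(** * Energy of a diagonally dominant matrix *)

Lemma mx_norm_entry (K : realDomainType) m n (A : 'M[K]_(m, n)) i j :
  `|A i j| <= `|A|.
Proof.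
rewrite [leRHS]/Num.Def.normr /= mx_normrE; apply/bigmax_geP; right => /=.
by exists (i, j).
Qed.

Lemma mx_norm_le (K : realDomainType) m n (A : 'M[K]_(m, n)) (b : K) :
  0 <= b -> (forall i j, `|A i j| <= b) -> `|A| <= b.
Proof.
by move=> b0 Ab; rewrite [leLHS]/Num.Def.normr /= mx_normrE; apply/bigmax_leP; split.
Qed.

Lemma mx_normM (K : realDomainType) m n p (A : 'M[K]_(m, n)) (B : 'M[K]_(n, p)) :
  `|A *m B| <= n%:R * (`|A| * `|B|).
Proof.
apply: mx_norm_le => [|i j]; first by rewrite !mulr_ge0.
rewrite mxE (le_trans (ler_norm_sum _ _ _))//.
rewrite (_ : n%:R * _ = \sum_(l < n) `|A| * `|B|); last first.
  by rewrite sumr_const card_ord mulr_natl.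
rewrite ler_sum// => l _.
by rewrite normrM ler_pM// mx_norm_entry.
Qed.

Lemma finite_pos_lb (R : realFieldType) (I : finType) (f : I -> R) :
  (forall i, 0 < f i) -> exists2 e, 0 < e & forall i, e <= f i.
Proof.
(* Starting the minimum at 1 keeps it positive when the index type is empty. *)
move=> f0; exists (\big[Order.min/1]_i f i).
  by elim/big_ind : _ => // x y x0 y0; rewrite lt_min x0.
by move=> i; exact: bigmin_le_cond.
Qed.

(** [|v|] is the maximum norm, so the term at an index where it is attained already suffices. *)
Lemma sqr_norm_le_sum (R : realDomainType) n (v : 'cV[R]_n) (f : 'I_n -> R) e :
  0 <= e -> (forall i, e <= f i) -> e * `|v| ^+ 2 <= \sum_i f i * v i 0 ^+ 2.
Proof.
move=> e0 ef; have f0 i : 0 <= f i := le_trans e0 (ef i).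
have [->|v0] := eqVneq v 0.
  by rewrite normr0 expr0n mulr0 sumr_ge0// => i _; rewrite mulr_ge0 ?sqr_ge0.
have [[i j] /= vij] : exists ij, `|v| = `|v ij.1 ij.2|.
  by apply: mx_norm_neq0; rewrite -[mx_norm v]/(`|v|) normr_eq0.
rewrite (bigD1 i)//= vij [j]ord1 -normrX ger0_norm ?sqr_ge0//.
rewrite (le_trans (ler_wpM2r (sqr_ge0 _) (ef i)))// lerDl sumr_ge0// => l _.
by rewrite mulr_ge0 ?sqr_ge0.
Qed.

Section energy.
Context {R : realType} {n : nat}.
Implicit Types (S A : 'M[R]_n) (D : 'rV[R]_n) (u v w z : 'cV[R]_n).

Definition energy S v : R := (v^T *m S *m v) 0 0.

Lemma energyE S v : energy S v = \sum_i \sum_j v i 0 * S i j * v j 0.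
Proof.
rewrite /energy mxE exchange_big; apply: eq_bigr => j _ /=.
by rewrite mxE mulr_suml; apply: eq_bigr => i _; rewrite mxE.
Qed.

Lemma energy_le S v : energy S v <= (n * n)%:R * `|S| * `|v| ^+ 2.
Proof.
have nT : `|v^T| <= `|v|.
  by apply: mx_norm_le => // i j; rewrite mxE mx_norm_entry.
apply: le_trans (ler_norm _) _.
apply: le_trans (mx_norm_entry _ _ _) _.
apply: le_trans (mx_normM _ _) _.
rewrite natrM -!mulrA ler_wpM2l// expr2 !mulrA ler_wpM2r//.
apply: le_trans (mx_normM _ _) _.
by rewrite -mulrA ler_wpM2l// mulrC ler_wpM2l.
Qed.

Definition dominant S :=
  [/\ S^T = S, forall i j, i != j -> S i j <= 0 & forall i, 0 < \sum_j S i j].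

(* S i j * v i * v j >= S i j * (v i ^ 2 + v j ^ 2) / 2, with equality on the
   diagonal, so the energy dominates the row sums weighted by the v i ^ 2. *)
Lemma energy_ge S : dominant S ->
  exists2 s, 0 < s & forall v, s * `|v| ^+ 2 <= energy S v.
Proof.
case=> symS offS rowS; have [s s0 sS] := finite_pos_lb rowS.
exists s => // v.
have symE i j : S j i = S i j by rewrite -[in LHS]symS mxE.
have key : \sum_i (\sum_j S i j) * v i 0 ^+ 2 <= energy S v.
  rewrite energyE.
  have -> : \sum_i (\sum_j S i j) * v i 0 ^+ 2 =
      \sum_i \sum_j S i j * ((v i 0 ^+ 2 + v j 0 ^+ 2) / 2).
    set L := LHS; transitivity ((L + L) / 2); first by rewrite /L; field.
    have {2}-> : L = \sum_i \sum_j S i j * v j 0 ^+ 2.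
      rewrite exchange_big; apply: eq_bigr => i _ /=; rewrite mulr_suml.
      by apply: eq_bigr => j _; rewrite symE.
    rewrite /L -big_split mulr_suml; apply: eq_bigr => i _ /=.
    rewrite mulr_suml -big_split mulr_suml; apply: eq_bigr => j _ /=.
    by field.
  apply: ler_sum => i _; apply: ler_sum => j _.
  have [->|/offS Sij] := eqVneq i j.
    by rewrite le_eqVlt; apply/orP; left; apply/eqP; field.
  by have := mulr_ge0_le0 (sqr_ge0 (v i 0 - v j 0)) Sij; nra.
apply: le_trans key; exact: sqr_norm_le_sum (ltW s0) sS.
Qed.

(** The relation reads w - v = - D S (v + w), and symmetry of S gives q(v) - q(w) = (v - w)^T S (v +
    w). *)
Lemma energy_drop S D A v w : S^T = S -> A = - (diag_mx D *m S) ->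
  (1%:M - A) *m w = (1%:M + A) *m v ->
  energy S v - energy S w = \sum_i D 0 i * ((S *m (v + w)) i 0) ^+ 2.
Proof.
move=> symS AE; rewrite mulmxBl mulmxDl !mul1mx => /eqP.
rewrite subr_eq -addrA -mulmxDr addrC -subr_eq => /eqP wv.
set y := S *m (v + w).
have {}wv : w - v = - (diag_mx D *m y) by rewrite wv AE mulNmx mulmxA.
transitivity (((v - w)^T *m y) 0 0).
  rewrite /y mulmxA mulmxDr linearB /= !mulmxBl /energy.
  have cross : (v^T *m S *m w) 0 0 = (w^T *m S *m v) 0 0.
    rewrite -[in RHS](trmxK (w^T *m S *m v)) [in RHS]mxE.
    by rewrite !trmx_mul trmxK symS mulmxA.
  have addE (M N : 'M[R]_1) : (M + N) 0 0 = M 0 0 + N 0 0 by rewrite mxE.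
  have oppE (M : 'M[R]_1) : (- M) 0 0 = - M 0 0 by rewrite mxE.
  by rewrite !(addE, oppE) cross; ring.
have -> : v - w = diag_mx D *m y by rewrite -opprB wv opprK.
rewrite mxE; apply: eq_bigr => i _.
by rewrite mxE mul_diag_mx mxE expr2 mulrA.
Qed.

End energy.

Lemma inj_unitmx (F : fieldType) n (M : 'M[F]_n) :
  (forall v : 'cV_n, M *m v = 0 -> v = 0) -> M \in unitmx.
Proof.
move=> injM; rewrite -unitmx_tr -row_free_unit; apply: inj_row_free => v vM.
apply/trmx_inj; rewrite trmx0; apply: injM.
by rewrite -[M]trmxK -trmx_mul vM trmx0.
Qed.

Lemma cayleyK (R : realType) n (A : 'M[R]_n) (v : 'cV_n) :
  1%:M - A \in unitmx -> (1%:M - A) *m (cayley A *m v) = (1%:M + A) *m v.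
Proof. by move=> uA; rewrite /cayley -mulmxA mulKVmx. Qed.

(** * Contraction of the energy by the Cayley transform *)

Section cayley_energy.
Context {R : realType} {n : nat}.
Variables (S : 'M[R]_n) (D : 'rV[R]_n).
Hypotheses (domS : dominant S) (D_ge0 : forall i, 0 <= D 0 i).
Implicit Types u v w z : 'cV[R]_n.

Let A := - (diag_mx D *m S).

Lemma dominant_sym : S^T = S. Proof. by case: domS. Qed.

Lemma energy_le0 v : energy S v <= 0 -> v = 0.
Proof.
have [s s0 /(_ v) /le_trans h] := energy_ge domS => /h.
rewrite pmulr_rle0// => v0; apply/eqP; rewrite -normr_eq0 -sqrf_eq0.
by rewrite eq_le v0 sqr_ge0.
Qed.

(** A kernel vector v of 1 - A is a step from 0 to v; energy cannot grow along a step, so q(v) <=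
    q(0) = 0. *)
Lemma sub1_unitmx : 1%:M - A \in unitmx.
Proof.
apply: inj_unitmx => v Av; apply: energy_le0.
have := @energy_drop _ _ S D A 0 v dominant_sym erefl.
rewrite mulmx0 => /(_ Av) e0; have : 0 <= energy S 0 - energy S v.
  by rewrite e0 sumr_ge0// => i _; rewrite mulr_ge0 ?sqr_ge0.
by rewrite {1}/energy mulmx0 mxE sub0r oppr_ge0.
Qed.

Lemma dominant_unitmx : S \in unitmx.
Proof.
apply: inj_unitmx => v Sv; apply: energy_le0.
by rewrite /energy -mulmxA Sv mulmx0 mxE.
Qed.

(* With y = S (v + C v), the energy drop is at least min D * |y|^2, while
   (1 - A) (v + C v) = 2 v makes v = N y a linear image of y. *)
Lemma cayley_energy_le : exists rho : R,
  [/\ 0 <= rho <= 1, (forall i, 0 < D 0 i) -> rho < 1 &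
      forall v, energy S (cayley A *m v) <= rho * energy S v].
Proof.
have drop v : 0 <= energy S v - energy S (cayley A *m v).
  rewrite (energy_drop dominant_sym erefl (cayleyK v sub1_unitmx)) sumr_ge0// => i _.
  by rewrite mulr_ge0 ?sqr_ge0.
have [/forallP D_gt0|/forallPn Dn] := boolP [forall i, 0 < D 0 i]; last first.
  exists 1; split=> [|D_gt0|v]; first by rewrite ler01 lexx.
    by case: Dn => i; rewrite D_gt0.
  by rewrite mul1r -subr_ge0.
have [e e0 De] := finite_pos_lb D_gt0.
pose N := 2^-1 *: ((1%:M - A) *m invmx S).
(* The summand e ensures 0 < e <= K, so that 1 - e / K lies in [0, 1). *)
pose K := e + (n * n)%:R * `|S| * (n%:R * `|N|) ^+ 2.
have eK : e <= K by rewrite lerDl mulr_ge0 ?sqr_ge0// mulr_ge0.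
have K0 : 0 < K := lt_le_trans e0 eK.
exists (1 - e / K); split=> [|_|v].
- by rewrite subr_ge0 gerBl ler_pdivrMr// mul1r eK divr_ge0// ltW.
- by rewrite gtrBl divr_gt0.
rewrite mulrBl mul1r lerBrDr addrC -lerBrDr.
rewrite (energy_drop dominant_sym erefl (cayleyK v sub1_unitmx)); set y := S *m _.
have vN : v = N *m y.
  rewrite /N -scalemxAl -mulmxA mulKmx ?dominant_unitmx// mulmxDr cayleyK ?sub1_unitmx//.
  rewrite -mulmxDl addrACA addNr addr0 mulmxDl mul1mx scalerDr.
  by rewrite -scalerDl (_ : 2^-1 + 2^-1 = 1 :> R) ?scale1r//; field.
have vy : energy S v <= K * `|y| ^+ 2.
  apply: le_trans (energy_le _ _) _.
  apply: (@le_trans _ _ ((n * n)%:R * `|S| * (n%:R * `|N|) ^+ 2 * `|y| ^+ 2)); last first.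
    by rewrite ler_wpM2r ?sqr_ge0// lerDr ltW.
  rewrite -[X in _ <= X]mulrA -exprMn ler_wpM2l ?mulr_ge0//.
  rewrite lerXn2r ?nnegrE ?mulr_ge0//.
  by rewrite {1}vN -mulrA mx_normM.
have ey : e * `|y| ^+ 2 <= \sum_i D 0 i * y i 0 ^+ 2.
  exact: sqr_norm_le_sum (ltW e0) De.
apply: le_trans ey; rewrite -mulrA ler_wpM2l ?(ltW e0)//.
by rewrite ler_pdivrMl.
Qed.

(** The energy is comparable to the square of the maximum norm, so its decay passes to the powers; K
    is the ratio of the two comparison constants. *)
Lemma cayley_expr_le : exists K rho : R,
  [/\ 0 <= rho <= 1, (forall i, 0 < D 0 i) -> rho < 1 &
      forall p, `|cayley A ^+ p| ^+ 2 <= K * rho ^+ p].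
Proof.
have [rho [/andP[r0 r1] rlt1 Cv]] := cayley_energy_le.
have [s s0 sE] := energy_ge domS.
exists ((n * n)%:R * `|S| / s), rho; split=> [||p]; first by rewrite r0.
  by [].
have Cp v : energy S (cayley A ^+ p *m v) <= rho ^+ p * energy S v.
  elim: p => [|p IH]; first by rewrite !expr0 mul1r mul1mx.
  rewrite !exprS -mulmxA -mulrA.
  by apply: le_trans (Cv _) _; rewrite ler_wpM2l.
set M := cayley A ^+ p in Cp *.
set b := _ * rho ^+ p.
have b0 : 0 <= b by rewrite /b !mulr_ge0 ?exprn_ge0// invr_ge0 ltW.
rewrite -[leRHS]sqr_sqrtr// lerXn2r ?nnegrE ?sqrtr_ge0//.
apply: mx_norm_le => [|i j]; first exact: sqrtr_ge0.
rewrite -sqrtr_sqr ler_wsqrtr//.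
pose v : 'cV[R]_n := delta_mx j 0.
have -> : M i j = (M *m v) i 0 by rewrite -colE mxE.
have v1 : `|v| <= 1.
  apply: mx_norm_le => // a c; rewrite mxE.
  by case: (_ && _); rewrite ?normr1 ?normr0.
rewrite -real_normK ?num_real//.
apply: (@le_trans _ _ (`|M *m v| ^+ 2)).
  by rewrite lerXn2r ?nnegrE// mx_norm_entry.
rewrite -(ler_pM2l s0); apply: le_trans (sE _) _; apply: le_trans (Cp v) _.
rewrite /b mulrC mulrA ler_wpM2r ?exprn_ge0//.
rewrite mulrCA divff ?gt_eqF// mulr1.
apply: le_trans (energy_le _ _) _.
by rewrite ler_piMr ?mulr_ge0// exprn_ile1.
Qed.

End cayley_energy.

(** * Powers and spectral radius *)

(** x times the bound for p exceeds the bound for p + 1 by p (x - 1)^2. Below, the inequality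
    replaces p-th roots in passing from powers of an eigenvalue to its modulus. *)
Lemma bernoulli_ineq (R : realDomainType) (x : R) p :
  0 <= x -> 1 + p%:R * (x - 1) <= x ^+ p.
Proof.
move=> x0; elim: p => [|p IH]; first by rewrite mul0r addr0 expr0.
rewrite exprS; apply: le_trans (ler_wpM2l x0 IH).
by rewrite -natr1; have := mulr_ge0 (ler0n R p) (sqr_ge0 (x - 1)); nra.
Qed.

Section spectral.
Context {R : realType} {n : nat}.
Implicit Types (M : 'M[R]_n) (z : R[i]).
Import ComplexField.Normc.

Lemma normc_ge0 z : 0 <= normc z.
Proof. by case: z => x y; exact: sqrtr_ge0. Qed.

(** Read v M^p = z^p v at a coordinate j where |v_j| is largest: each of the n summands is at most
    |v_j| |M^p|, and |v_j| cancels. *)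
Lemma eigenvalue_normc_le M z p : eigenvalue (map_mx (real_complex R) M) z ->
  normc z ^+ p <= n%:R * `|M ^+ p|.
Proof.
move=> /eigenvalueP[v vM v0].
have normcE (a : R[i]) : (normc a)%:C%C = `|a| by case: a.
have [j0 vj0] : exists j, v 0 j != 0.
  by move/rV0Pn: v0.
have [j _ jmax] := @arg_maxP _ R _ j0 predT (fun j => normc (v 0 j)) isT.
have vj_gt0 : 0 < normc (v 0 j).
  apply: lt_le_trans (jmax j0 isT).
  by rewrite lt_def normc_ge0 andbT; apply: contra vj0 => /eqP/eq0_normc ->.
have vMp : v *m map_mx (real_complex R) (M ^+ p) = z ^+ p *: v.
  elim: p => [|p IH].
    by rewrite !expr0 scale1r map_mx1 mulmx1.
  by rewrite exprS map_mxM mulmxA vM -scalemxAl IH scalerA exprS.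
rewrite -(ler_pM2r vj_gt0) -lecR !rmorphM /= rmorphXn /= !normcE -normrX -normrM.
have -> : z ^+ p * v 0 j = \sum_i v 0 i * ((M ^+ p) i j)%:C%C.
  move/matrixP: vMp => /(_ 0 j); rewrite !mxE => <-.
  by apply: eq_bigr => i _; rewrite mxE.
apply: le_trans (ler_norm_sum _ _ _) _.
have -> : n%:R%:C%C * `|M ^+ p|%:C%C * `|v 0 j| =
    \sum_(i < n) `|v 0 j| * `|M ^+ p|%:C%C :> R[i].
  have -> : n%:R%:C%C = n%:R :> R[i] by exact: (rmorph_nat (real_complex R)).
  by rewrite sumr_const card_ord mulrAC -mulrA mulr_natl.
apply: ler_sum => i _; rewrite normrM ler_pM//.
  by rewrite -!normcE lecR; exact: jmax.
have -> : `|((M ^+ p) i j)%:C%C| = (`|(M ^+ p) i j|)%:C%C.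
  by rewrite normc_def /= expr0n addr0 sqrtr_sqr.
by rewrite lecR mx_norm_entry.
Qed.

Lemma spectral_radius_le M b : 0 <= b ->
  (forall z, eigenvalue (map_mx (real_complex R) M) z -> normc z <= b) ->
  spectral_radius M <= b.
Proof.
move=> b0 Mb; rewrite /spectral_radius; set E := (X in sup X).
(* The supremum of the empty set is 0 by convention; this case relies on 0 <= b. *)
have [->|/set0P E0] := eqVneq E set0; first by rewrite sup0.
by apply: ge_sup => // _ [z Mz <-]; exact: Mb.
Qed.

(** By Bernoulli, the powers of an eigenvalue of modulus above 1 would grow at least linearly, past
    the bound n K. *)
Lemma spectral_radius_le1 M K : (forall p, `|M ^+ p| <= K) ->
  spectral_radius M <= 1.
Proof.
move=> MK; apply: spectral_radius_le => // z Mz; rewrite leNgt; apply/negP => z1.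
have K0 : 0 <= n%:R * K.
  by rewrite mulr_ge0//; apply: le_trans (MK 0%N).
have d0 : 0 < normc z - 1 by rewrite subr_gt0.
have [p] : exists p : nat, n%:R * K / (normc z - 1) < p%:R.
  by exists (Num.trunc (n%:R * K / (normc z - 1))).+1; exact: truncnS_gt.
rewrite ltr_pdivrMr//; apply/negP; rewrite -leNgt.
have := bernoulli_ineq p (normc_ge0 z); have := eigenvalue_normc_le p Mz.
have := ler_wpM2l (ler0n R n) (MK p); lra.
Qed.

(** A bound uniform in z keeps the supremum strictly below 1: once n |M^p| <= 1/2, Bernoulli gives
    |z| <= 1 - 1/(2p). *)
Lemma spectral_radius_lt1 M : (fun p : nat => M ^+ p) @ \oo --> (0 : 'M[R]_n) ->
  spectral_radius M < 1.
Proof.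
move=> M0.
have [p p0 Mp] : exists2 p : nat, (0 < p)%N & n%:R * `|M ^+ p| <= 1 / 2.
  (* Using n + 1 instead of n keeps the threshold positive when n = 0. *)
  have e0 : 0 < (2 * (n%:R + 1))^-1 :> R by rewrite invr_gt0 mulr_gt0// ltr_wpDl.
  have /cvgr0Pnorm_le/(_ _ e0)[N _ NM] := M0.
  exists N.+1 => //; have := NM N.+1 (leqnSn N).
  move=> /(ler_wpM2l (ler0n R n))/le_trans; apply.
  by rewrite ler_pdivrMr ?mulr_gt0 ?ltr_wpDl// mul1r mulKf ?pnatr_eq0// lerDl.
have p0' : 0 < p%:R :> R by rewrite ltr0n.
have p1 : (2 * p%:R)^-1 <= 1 :> R.
  rewrite invf_le1 ?mulr_gt0//.
  have : 1 <= p%:R :> R by rewrite ler1n.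
  lra.
apply: (@le_lt_trans _ _ (1 - (2 * p%:R)^-1)); last first.
  by rewrite gtrBl invr_gt0 mulr_gt0.
apply: spectral_radius_le => [|z Mz]; first by rewrite subr_ge0.
have := bernoulli_ineq p (normc_ge0 z); have := eigenvalue_normc_le p Mz.
move=> /le_trans/(_ Mp) zp /le_trans/(_ zp) h.
have e : p%:R * (2 * p%:R)^-1 = 1 / 2 :> R by field; rewrite gt_eqF.
rewrite -(ler_pM2l p0') mulrBr e; lra.
Qed.

End spectral.

(** * The alternating-direction schemes *)

Section schemes.
Context {R : realType} {n : nat}.
Implicit Types (A B : 'M[R]_n) (U : 'cV[R]_n) (tau : R) (step : scheme R n).

Lemma comm_invmx A B : A \in unitmx -> comm_mx A B -> comm_mx (invmx A) B.
Proof.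
move=> uA AB; rewrite /comm_mx -[LHS](mulmxK uA) -(mulmxA _ B).
by rewrite -AB mulKmx.
Qed.

Lemma comm_cayley A B : 1%:M - A \in unitmx -> comm_mx A B ->
  comm_mx (cayley A) B.
Proof.
move=> uA /comm_mx_sym AB; apply/comm_mx_sym/comm_mxM.
  apply/comm_mx_sym/comm_invmx => //; apply/comm_mx_sym/comm_mxB => //.
  exact: comm_mx1.
by apply: comm_mxD => //; exact: comm_mx1.
Qed.

Lemma mulmx_unit_eq A (u v : 'cV[R]_n) :
  A \in unitmx -> A *m u = v <-> u = invmx A *m v.
Proof. by move=> uA; split=> [<-|->]; [rewrite mulKmx|rewrite mulKVmx]. Qed.

Lemma D_AD_well_posed A B tau : 1%:M - A \in unitmx -> 1%:M - B \in unitmx ->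
  well_posed (D_AD A B tau).
Proof.
move=> uA uB F U; exists (invmx (1%:M - B) *m
  (invmx (1%:M - A) *m ((1%:M + A + B *+ 2) *m U + tau *: F) - B *m U)); split.
  eexists; split; last exact/mulmx_unit_eq.
  exact/mulmx_unit_eq.
by move=> V [Us [/(mulmx_unit_eq _ _ uA) -> /(mulmx_unit_eq _ _ uB) ->]].
Qed.

Lemma PR_AD_well_posed A B tau : 1%:M - A \in unitmx -> 1%:M - B \in unitmx ->
  well_posed (PR_AD A B tau).
Proof.
move=> uA uB F U; exists (invmx (1%:M - B) *m
  ((1%:M + A) *m (invmx (1%:M - A) *m ((1%:M + B) *m U + (tau / 2) *: F))
   + (tau / 2) *: F)); split.
  eexists; split; last exact/mulmx_unit_eq.
  exact/mulmx_unit_eq.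
by move=> V [Us [/(mulmx_unit_eq _ _ uA) -> /(mulmx_unit_eq _ _ uB) ->]].
Qed.

(** Multiply the second stage by 1 - A and use (1 + A + 2B) - (1 - A) B = (1 + A) (1 + B). *)
Lemma D_AD_factored A B tau F U U' : D_AD A B tau F U U' ->
  (1%:M - A) *m (1%:M - B) *m U' = (1%:M + A) *m (1%:M + B) *m U + tau *: F.
Proof.
move=> [Us [AUs BU']]; rewrite -mulmxA BU' mulmxBr AUs.
rewrite addrAC mulmxA -mulmxBl; congr (_ *m _ + _).
rewrite mulmxBl mulmxDl !mul1mx mulmxDr mulmx1 mulr2n.
move: (A *m B) => AB; apply/matrixP => i j; rewrite !mxE; ring.
Qed.

(** Multiply the second stage by 1 - A, which commutes with 1 + A; the sources add up to (tau / 2)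
    ((1 + A) + (1 - A)) F = tau F. *)
Lemma PR_AD_factored A B tau F U U' : PR_AD A B tau F U U' ->
  (1%:M - A) *m (1%:M - B) *m U' = (1%:M + A) *m (1%:M + B) *m U + tau *: F.
Proof.
move=> [Us [AUs BU']]; rewrite -mulmxA BU' mulmxDr mulmxA.
have -> : (1%:M - A) *m (1%:M + A) = (1%:M + A) *m (1%:M - A).
  rewrite mulmxBl mulmxDl !mul1mx !mulmxDr mulmxN !mulmx1.
  by move: (A *m A) => AA; apply/matrixP => i j; rewrite !mxE; ring.
rewrite -mulmxA AUs mulmxDr mulmxA -addrA; congr (_ + _).
rewrite -mulmxDl addrACA subrr addr0 mulmxDl mul1mx -scalerDl.
by congr (_ *: _); field.
Qed.

Lemma factored_propagates A B step (f : 'cV[R]_n -> 'cV[R]_n) :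
  (forall F U U', step F U U' ->
    (1%:M - A) *m (1%:M - B) *m U' = (1%:M + A) *m (1%:M + B) *m U + f F) ->
  propagates_errors A B step.
Proof.
move=> fact F U U' V V' /fact UE /fact VE.
by rewrite mulmxBr UE VE opprD addrACA subrr addr0 -mulmxBr.
Qed.

Section errors.
Variables (A B : 'M[R]_n) (step : scheme R n).
Hypotheses (uA : 1%:M - A \in unitmx) (uB : 1%:M - B \in unitmx).
Hypotheses (AB : comm_mx A B) (stepP : propagates_errors A B step).

(** Commutation enters twice: 1 - B must pass [cayley A] for one step to multiply the error by both
    Cayley transforms, and the factors of p steps must be sorted into two powers. *)
Lemma two_runs_error (U V : nat -> 'cV[R]_n) p : two_runs step U V ->
  U p - V p = cayley A ^+ p *m (cayley B ^+ p *m (U 0%N - V 0%N)).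
Proof.
move=> [F UV].
have cAB : comm_mx (cayley A) B by exact: comm_cayley.
have cAcB : comm_mx (cayley A) (cayley B).
  by apply/comm_mx_sym/comm_cayley => //; exact: comm_mx_sym.
elim: p => [|p IH]; first by rewrite !expr0 !mul1mx.
have -> : cayley A ^+ p.+1 *m (cayley B ^+ p.+1 *m (U 0%N - V 0%N)) =
    cayley A *m (cayley B *m (U p - V p)).
  rewrite IH; move: (cayley A) (cayley B) (U 0%N - V 0%N) cAcB => X Y E XY.
  rewrite !exprS -!mulmxA; congr (_ *m _); rewrite !mulmxA; congr (_ *m _ *m _).
  by have /comm_mx_sym := XY; rewrite comm_mxE => /(@commrX _ _ _ p)/esym.
have [] := UV p; move=> /stepP h /h {h}.
have uAB : (1%:M - A) *m (1%:M - B) \in unitmx by rewrite unitmx_mul uA.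
move/(mulmx_unit_eq _ _ uAB) => ->; apply/esym/(mulmx_unit_eq _ _ uAB).
have cA1B : comm_mx (cayley A) (1%:M - B).
  by apply: comm_mxB => //; exact: comm_mx1.
rewrite -(mulmxA (1%:M - A)) (mulmxA (1%:M - B) (cayley A)) -cA1B.
by rewrite -(mulmxA (cayley A)) !cayleyK// mulmxA.
Qed.

Lemma two_runs_error_le (U V : nat -> 'cV[R]_n) p : two_runs step U V ->
  `|U p - V p| <=
    n%:R * (`|cayley A ^+ p| * (n%:R * (`|cayley B ^+ p| * `|U 0%N - V 0%N|))).
Proof.
move=> /two_runs_error ->; apply: le_trans (mx_normM _ _) _.
by rewrite !ler_wpM2l// mx_normM.
Qed.

End errors.

End schemes.

(** * From dominance to stability of a scheme *)

Section stability.
Context {R : realType} {n : nat}.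
Variables (S1 S2 : 'M[R]_n) (D1 D2 : 'rV[R]_n) (step : scheme R n).
Hypotheses (domS1 : dominant S1) (domS2 : dominant S2).
Hypotheses (D1_ge0 : forall i, 0 <= D1 0 i) (D2_ge0 : forall i, 0 <= D2 0 i).
Let A := - (diag_mx D1 *m S1).
Let B := - (diag_mx D2 *m S2).
Hypotheses (AB : comm_mx A B) (wp : well_posed step).
Hypothesis prop : propagates_errors A B step.

Lemma dominant_weakly_stable : weakly_stable A B step.
Proof.
have bounded (S : 'M[R]_n) (D : 'rV[R]_n) : dominant S -> (forall i, 0 <= D 0 i) ->
    exists K, 0 <= K /\ forall p, `|cayley (- (diag_mx D *m S)) ^+ p| <= K.
  move=> domS D0; have [K [rho [/andP[r0 r1] _ Kr]]] := cayley_expr_le domS D0.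
  (* The estimate bounds the square of the norm by K, and x^2 <= K implies x <= K + 1. *)
  exists (K + 1); have K0 : 0 <= K.
    by have := Kr 0%N; rewrite expr0 mulr1; apply: le_trans; exact: sqr_ge0.
  split=> [|p]; first by rewrite addr_ge0 ?ler01.
  have := Kr p; have := ler_wpM2l K0 (exprn_ile1 p r0 r1).
  by have := normr_ge0 (cayley (- (diag_mx D *m S)) ^+ p); nra.
have [K1 [K10 hK1]] := bounded _ _ domS1 D1_ge0.
have [K2 [K20 hK2]] := bounded _ _ domS2 D2_ge0.
have uA := sub1_unitmx domS1 D1_ge0; have uB := sub1_unitmx domS2 D2_ge0.
split=> //; first by split; split=> //; by [exact: spectral_radius_le1|exists K1|exists K2].
exists (n%:R * (K1 * (n%:R * K2))) => U V UV p.
apply: le_trans (two_runs_error_le uA uB AB prop p UV) _.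
by rewrite -!mulrA ler_wpM2l// ler_pM ?mulr_ge0// ler_wpM2l// ler_wpM2r.
Qed.

Lemma dominant_stable : (forall i, 0 < D1 0 i) -> (forall i, 0 < D2 0 i) ->
  stable A B step.
Proof.
have to0 (S : 'M[R]_n) (D : 'rV[R]_n) : dominant S -> (forall i, 0 <= D 0 i) ->
    (forall i, 0 < D 0 i) ->
    (fun p : nat => cayley (- (diag_mx D *m S)) ^+ p) @ \oo --> (0 : 'M[R]_n).
  move=> domS D0 D_gt0.
  have [K [rho [/andP[r0 _] /(_ D_gt0) r1 Kr]]] := cayley_expr_le domS D0.
  have g0 : geometric K rho @ \oo --> (0 : R).
    by apply: cvg_geometric; rewrite ger0_norm.
  apply/cvgr0Pnorm_le => e e0.
  have e20 : 0 < e ^+ 2 by rewrite exprn_gt0.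
  have /cvgr0Pnorm_le/(_ _ e20) := g0; apply: filterS => p /= /ler_normlW h.
  rewrite -(ler_pXn2r (ltn0Sn 1)) ?nnegrE ?(ltW e0)//.
  exact: le_trans (Kr p) h.
move=> D1_gt0 D2_gt0.
have A0 := to0 _ _ domS1 D1_ge0 D1_gt0; have B0 := to0 _ _ domS2 D2_ge0 D2_gt0.
have uA := sub1_unitmx domS1 D1_ge0; have uB := sub1_unitmx domS2 D2_ge0.
split=> //; first by split; split=> //; exact: spectral_radius_lt1.
move=> U V UV; apply: norm_cvg0.
apply: (@squeeze_cvgr _ _ _ _ (fun=> 0) (fun p => n%:R *
  (`|cayley A ^+ p| * (n%:R * (`|cayley B ^+ p| * `|U 0%N - V 0%N|))))).
- apply: nearW => p; rewrite normr_ge0/=.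
  exact: (two_runs_error_le uA uB AB prop p UV).
- exact: cvg_cst.
- have /norm_cvg0P nA0 := A0; have /norm_cvg0P nB0 := B0.
  rewrite -[X in _ --> X](mulr0 n%:R); apply: cvgMr.
  rewrite -[X in _ --> X](mul0r (n%:R * (0 * `|U 0%N - V 0%N|))).
  apply: cvgM => //; apply: cvgMr.
  by apply: cvgMl.
Qed.

End stability.

(** * Signs of the constants and weights *)

(** nu pi / 2 - pi lies in (- pi / 2, 0), where the cosine is positive, and a shift by pi reverses
    its sign. *)
Lemma kappa_lt0 (R : realType) (nu : R) : 1 < nu < 2 -> kappa nu < 0.
Proof.
move=> /andP[nu1 nu2]; rewrite /kappa invr_lt0 pmulr_rlt0//.
have pi0 := pi_gt0 R.
have : 0 < cos (nu * pi / 2 - pi).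
  by apply: cos_gt0_pihalf; apply/andP; split; nra.
by rewrite cosB cospi sinpi mulrN1 mulr0 addr0 oppr_gt0.
Qed.

(** With y = t / (2 s), raise y <= 1 + y <= exp y to the power s. Half of the decay of exp (- t) can
    thus absorb the power in the Gamma integrand. *)
Lemma powR_le_expR (R : realType) (s t : R) : 0 < s -> 0 <= t ->
  t `^ s <= (2 * s) `^ s * expR (t / 2).
Proof.
move=> s0 t0; have s20 : 0 < 2 * s by rewrite mulr_gt0.
have y0 : 0 <= t / (2 * s) by rewrite divr_ge0// ltW.
have -> : t / 2 = t / (2 * s) * s by field; rewrite gt_eqF.
rewrite expRM -powRM ?expR_ge0 ?(ltW s20)//.
apply: ge0_ler_powR; rewrite ?nnegrE ?(ltW s0)//.
  by rewrite mulr_ge0 ?(ltW s20) ?expR_ge0.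
rewrite mulrC -ler_pdivrMr//; apply: le_trans (expR_ge1Dx _).
by rewrite lerDr ler01.
Qed.

(** The real-valued integral would be 0 if the extended one were infinite, so integrability is
    proved alongside a positive lower bound. *)
Lemma Gamma_gt0 (R : realType) (z : R) : 1 < z -> 0 < Gamma z.
Proof.
move=> z1; rewrite /Gamma; set mu := lebesgue_measure.
pose f (t : R) := t `^ (z - 1) * expR (- t).
have s0 : 0 < z - 1 by rewrite subr_gt0.
have f0 t : 0 <= f t by rewrite mulr_ge0 ?powR_ge0 ?expR_ge0.
have mf (D : set (measurableTypeR R)) : measurable_fun D f.
  apply: (@measurable_funS _ _ _ _ setT) => //.
  apply: measurable_funM; first exact: measurable_powR.
  by apply: measurableT_comp => //; exact: oppr_measurable.
have intf : mu.-integrable `]0, +oo[ (EFin \o f).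
  have h0 : 0 < 2^-1 :> R by rewrite invr_gt0.
  have i1 : mu.-integrable `]0, +oo[ (EFin \o exponential_pdf 2^-1).
    exact: integrableS (integrable_exponential_pdf h0).
  (* The leading 2 cancels the rate 1/2 in the exponential density; the other factor comes from
     [powR_le_expR] with s = z - 1. *)
  have i2 := integrableZl _ (2 * (2 * (z - 1)) `^ (z - 1)) i1.
  apply: le_integrable (i2 _) => //; first exact/measurable_EFinP.
  move=> t /=; rewrite in_itv/= andbT => t0; rewrite lee_fin.
  rewrite exponential_pdfE ?(ltW t0)// !ger0_norm//; last first.
    by rewrite !mulr_ge0 ?powR_ge0 ?expR_ge0.
  have -> : 2 * (2 * (z - 1)) `^ (z - 1) * (2^-1 * expR (- 2^-1 * t)) =
     (2 * (z - 1)) `^ (z - 1) * expR (t / 2) * expR (- t).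
    rewrite -[in RHS]mulrA -expRD (_ : t / 2 - t = - 2^-1 * t); last by field.
    by field.
  by rewrite ler_wpM2r ?expR_ge0// powR_le_expR// ltW.
(* On ]1, 2[, of length 1, t ^ (z - 1) is at least 1 and exp (- t) at least exp (- 2). *)
have lb : ((expR (- 2))%:E <= \int[mu]_(t in `]0%R, +oo[) (f t)%:E)%E.
  have sub : (`]1, 2[ : set R) `<=` `]0, +oo[.
    by move=> t /=; rewrite !in_itv/= andbT => /andP[t1 _]; apply: lt_trans t1.
  apply: (@le_trans _ _ (\int[mu]_(t in `]1%R, 2%R[) (f t)%:E)%E); last first.
    apply: ge0_subset_integral => //; first exact/measurable_EFinP.
    by move=> t _; rewrite lee_fin.
  apply: (@le_trans _ _ (\int[mu]_(t in `]1%R, 2%R[) cst (expR (- 2))%:E t)%E).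
    have mu12 : mu `]1%R, 2%R[%classic = 1%E.
      rewrite /mu lebesgue_measure_itv/= lte_fin ltr1n -EFinD.
      by congr _%:E; field.
    by rewrite integral_cst// [X in (_ <= _ * X)%E]mu12 mule1.
  apply: ge0_le_integral => //.
  - by move=> t _; rewrite lee_fin expR_ge0.
  - exact/measurable_EFinP.
  - move=> t /=; rewrite in_itv/= => /andP[t1 t2]; rewrite lee_fin /f.
    rewrite -[leLHS]mul1r ler_pM ?expR_ge0//; last by rewrite ler_expR lerN2 ltW.
    apply: (@le_trans _ _ (1 `^ (z - 1))); first by rewrite powR1.
    apply: ge0_ler_powR; rewrite ?nnegrE ?(ltW s0) ?(ltW t1)//.
    by rewrite ltW// (lt_trans _ t1).
apply: fine_gt0; rewrite (lt_le_trans _ lb) ?lte_fin ?expR_gt0//=.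
have := integrable_fin_num _ intf.
by rewrite ge0_fin_numE; [exact|apply: le_trans lb; rewrite lee_fin expR_ge0].
Qed.

(** * Forward differences of powers *)

Section power_differences.
Context {R : realType}.
Implicit Types (s x : R) (k : nat).

Fixpoint pdiff k s x : R :=
  if k is k'.+1 then pdiff k' s (x + 1) - pdiff k' s x else x `^ s.

Lemma is_derive_pdiff k s x : 0 < x ->
  is_derive x 1 (pdiff k s) (s * pdiff k (s - 1) x).
Proof.
elim: k x => [|k IH] x x0 /=; first exact: is_derive1_powR.
rewrite mulrBr; apply: is_deriveB; last exact: IH.
have x10 : 0 < x + 1 by rewrite addr_gt0.
have := IH _ x10 => dk.
have ds : is_derive x 1 (fun y : R => y + 1) 1.
  by apply: is_derive_eq; rewrite addr0.
have := @is_derive1_comp _ (pdiff k s) (fun y => y + 1) x _ _ dk ds.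
by rewrite mulr1.
Qed.

Lemma continuous_pdiff k s x : 0 < x -> {for x, continuous (pdiff k s)}.
Proof.
move=> x0; have d := is_derive_pdiff k s x0.
by apply: differentiable_continuous; apply/derivable1_diffP.
Qed.

(** It supplies continuity at the left end 0 for the mean value theorem; the shifted term is
    evaluated near 1, where continuity is already known. *)
Lemma pdiff_cvg_right0 k s : 0 < s -> pdiff k s x @[x --> 0^'+] --> pdiff k s 0.
Proof.
move=> s0; elim: k => [|k IH] /=.
  by rewrite powR0 ?gt_eqF//; exact: powR_cvg0.
apply: cvgB => //; apply: cvg_at_right_filter.
have c1 : {for 0 + 1, continuous (pdiff k s)}.
  by apply: continuous_pdiff; rewrite add0r.
apply: (@continuous_comp _ _ _ (fun y : R => y + 1) (pdiff k s)) c1.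
by apply: cvgD; [exact: cvg_id|exact: cvg_cst].
Qed.

(** The mean value theorem trades one difference for one derivative. At x = 0 continuity requires 0
    < s; the points produced are positive, so the step can be iterated. *)
Lemma pdiff_MVT k s x : 0 <= x -> 0 < s \/ 0 < x ->
  exists2 c, 0 < c & pdiff k.+1 s x = s * pdiff k (s - 1) c.
Proof.
move=> x0 sx; have xx1 : x < x + 1 by rewrite ltrDl.
have [|||c] := @MVT _ (pdiff k s) (fun c => s * pdiff k (s - 1) c) x (x + 1) => //.
- move=> c; rewrite in_itv/= => /andP[xc _]; apply: is_derive_pdiff.
  exact: le_lt_trans xc.
- apply/continuous_within_itvP => //; split.
  + move=> c; rewrite in_itv/= => /andP[xc _]; apply: continuous_pdiff.
    exact: le_lt_trans xc.
  + move: x0; rewrite le_eqVlt => /orP[/eqP x0|x0].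
      rewrite -x0; apply: pdiff_cvg_right0.
      by case: sx => //; rewrite -x0 ltxx.
    by apply: cvg_at_right_filter; exact: continuous_pdiff.
  + apply: cvg_at_left_filter; apply: continuous_pdiff.
    exact: le_lt_trans xx1.
- rewrite in_itv/= => /andP[xc _] /=; rewrite addrAC subrr add0r mulr1 => ->.
  by exists c => //; exact: le_lt_trans xc.
Qed.

(** Three mean value steps give s (s - 1) (s - 2) e ^ (s - 3) with e > 0, where only s - 2 is
    negative. *)
Lemma pdiff3_lt0 s x : 1 < s < 2 -> 0 <= x -> pdiff 3 s x < 0.
Proof.
move=> /andP[s1 s2] x0; have s0 : 0 < s by apply: lt_trans s1.
have [c c0 ->] := pdiff_MVT 2 x0 (or_introl s0).
have [c' c'0 ->] := pdiff_MVT 1 (s := s - 1) (ltW c0) (or_intror c0).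
have [e e0 ->] := pdiff_MVT 0 (s := s - 1 - 1) (ltW c'0) (or_intror c'0).
rewrite /= pmulr_rlt0// pmulr_rlt0 ?subr_gt0// nmulr_rlt0 ?powR_gt0//.
lra.
Qed.

(** A fourth mean value step brings in s - 3, a second negative factor. *)
Lemma pdiff4_gt0 s x : 1 < s < 2 -> 0 <= x -> 0 < pdiff 4 s x.
Proof.
move=> /andP[s1 s2] x0; have s0 : 0 < s by apply: lt_trans s1.
have [c c0 ->] := pdiff_MVT 3 x0 (or_introl s0).
have [c' c'0 ->] := pdiff_MVT 2 (s := s - 1) (ltW c0) (or_intror c0).
have [e e0 ->] := pdiff_MVT 1 (s := s - 1 - 1) (ltW c'0) (or_intror c'0).
have [f f0 ->] := pdiff_MVT 0 (s := s - 1 - 1 - 1) (ltW e0) (or_intror e0).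
rewrite /= pmulr_rgt0// pmulr_rgt0 ?subr_gt0// nmulr_rgt0; last by lra.
by rewrite nmulr_rlt0 ?powR_gt0//; lra.
Qed.

End power_differences.

(** * Signs and row sums of the Riesz weights *)

Section weights.
Context {R : realType} (nu : R).
Hypothesis nuP : 1 < nu < 2.

Let nuP' : 1 < 3 - nu < 2. Proof. by move/andP: nuP => [? ?]; lra. Qed.

Lemma g_pdiff m : g nu m.+3 = pdiff 4 (3 - nu) m%:R.
Proof.
rewrite /g /pdiff; move: (3 - nu) => p; rewrite !subSS !subn0 -!natr1; ring.
Qed.

Lemma powR_5sub : 2 `^ (5 - nu) = 4 * 2 `^ (3 - nu) :> R.
Proof.
have -> : 5 - nu = 2%:R + (3 - nu) by ring.
rewrite powRD ?pnatr_eq0 ?implybT//.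
by rewrite powR_mulrn// -natrX.
Qed.

Lemma g1_lt0 : g nu 1 < 0.
Proof.
rewrite /g addrC subr_lt0.
have -> : 4 = 2 `^ 2%:R :> R by rewrite powR_mulrn// -natrX.
move/andP: nuP' => [_ p2]; rewrite /powR pnatr_eq0 ltr_expR ltr_pM2r//.
by rewrite ln_gt0 ?ltr1n.
Qed.

(* With q = 2 - (3 - nu), dividing by 2 ^ (- q) leaves
   7 * 2 ^ q + 9 * (2 / 3) ^ q - 16, and e ^ x >= 1 + x bounds it below by
   q * (16 ln 2 - 9 ln 3) = q * ln (2 ^ 16 / 3 ^ 9). *)
Lemma g0Dg2_ge0 : 0 <= g nu 0 + g nu 2.
Proof.
rewrite /g powR_5sub.
have [q q0 ->] : exists2 q, 0 <= q & 3 - nu = 2%:R - q.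
  by exists (nu - 1); [move/andP: nuP => [? ?]; lra|ring].
rewrite !powRB ?pnatr_eq0 ?implybT// !powR_mulrn// -!natrX.
have p2 : 0 < 2 `^ q :> R by rewrite powR_gt0.
have p3 : 0 < 3 `^ q :> R by rewrite powR_gt0.
have e2 : 2 `^ q = expR (q * ln 2) :> R by rewrite /powR pnatr_eq0.
have e3 : 3 `^ q = expR (q * ln 3) :> R by rewrite /powR pnatr_eq0.
have h2 := expR_ge1Dx (q * ln 2 : R).
have h3 := expR_ge1Dx (q * ln 2 - q * ln 3 : R).
rewrite -e2 in h2; rewrite expRB -e2 -e3 in h3.
have l23 : 9 * ln 3 <= 16 * ln 2 :> R.
  rewrite !mulr_natl -!lnXn// ler_ln ?posrE ?exprn_gt0//.
  by rewrite -!natrX ler_nat.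
have key : 0 <= 7 * 2 `^ q + 9 * (2 `^ q / 3 `^ q) - 16 :> R by nra.
have -> : 1 + (6 - 4 * ((2 ^ 2)%:R / 2 `^ q) + (3 ^ 2)%:R / 3 `^ q) =
   (7 * 2 `^ q + 9 * (2 `^ q / 3 `^ q) - 16) / 2 `^ q.
  by field; rewrite !gt_eqF.
by rewrite divr_ge0// ltW.
Qed.

(** [gtilde] depends only on the distance of its indices; as a function of that distance it can be
    summed along either side of the diagonal. *)
Definition offset_weight d : R :=
  match d with 0 => 2 * g nu 1 | 1 => g nu 0 + g nu 2 | _ => g nu d.+1 end.

Lemma gtildeE i m : gtilde nu i m = offset_weight ((i - m) + (m - i))%N.
Proof. by []. Qed.

Lemma offset_weight_ge0 d : 0 <= offset_weight d.+1.
Proof.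
case: d => [|d]; first exact: g0Dg2_ge0.
by rewrite /offset_weight g_pdiff ltW// pdiff4_gt0.
Qed.

(** g_1 is half of the diagonal weight. For L > 0 the sum telescopes to the third difference of x ^
    (3 - nu) at L - 1, starting from g_1 + g_0 + g_2, the one at 0. *)
Lemma half_row_sum_lt0 L : g nu 1 + \sum_(0 <= d < L) offset_weight d.+1 < 0.
Proof.
case: L => [|L]; first by rewrite big_nil addr0 g1_lt0.
suff -> : g nu 1 + \sum_(0 <= d < L.+1) offset_weight d.+1 = pdiff 3 (3 - nu) L%:R.
  exact: pdiff3_lt0.
elim: L => [|L IH].
  rewrite big_nat1 /offset_weight /g powR_5sub /pdiff !add0r powR1 powR0 ?gt_eqF//.
    rewrite [1 + 1](_ : _ = 2) // [2 + 1](_ : _ = 3)//; last by ring.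
    by ring.
  by move/andP: nuP' => [/(lt_trans ltr01)].
have hL : offset_weight L.+2 = pdiff 3 (3 - nu) (L%:R + 1) - pdiff 3 (3 - nu) L%:R.
  exact: g_pdiff.
by rewrite big_nat_recr// addrA IH [offset_weight _]hL natr1 addrC subrK.
Qed.

Lemma gtilde_sym i m : gtilde nu i m = gtilde nu m i.
Proof. by rewrite /gtilde addnC. Qed.

Lemma gtilde_ge0 i m : i != m -> 0 <= gtilde nu i m.
Proof.
rewrite gtildeE => im; have : (0 < (i - m) + (m - i))%N.
  by rewrite addn_gt0 !subn_gt0 -neq_ltn eq_sym.
by case: (_ + _)%N => // d _; exact: offset_weight_ge0.
Qed.

(** The diagonal weight 2 g_1 is shared between the i entries on the left and the n - i - 1 on the
    right, giving two half rows. *)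
Lemma gtilde_row_lt0 n i : (i < n)%N -> \sum_(m < n) gtilde nu i m < 0.
Proof.
move=> ilt; rewrite -(big_mkord xpredT (gtilde nu i)).
rewrite (big_cat_nat (n := i)) ?(ltnW ilt)//=.
rewrite [X in _ + X]big_ltn// (gtildeE i i) subnn addn0.
have -> : \sum_(0 <= m < i) gtilde nu i m = \sum_(0 <= d < i) offset_weight d.+1.
  rewrite big_nat_rev; apply: eq_big_nat => m /andP[_ mi].
  by rewrite gtildeE add0n; congr offset_weight; lia.
have -> : \sum_(i.+1 <= m < n) gtilde nu i m = \sum_(0 <= d < n - i.+1) offset_weight d.+1.
  rewrite -{1}[i.+1]add0n big_addn; apply: eq_big_nat => m _.
  by rewrite gtildeE; congr offset_weight; lia.
have h0 : offset_weight 0 = 2 * g nu 1 by [].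
have := half_row_sum_lt0 i; have := half_row_sum_lt0 (n - i.+1).
rewrite h0; move: (g nu 1) => g1; lra.
Qed.

End weights.

(** * The matrices on the grid *)

Section kronecker.
Context {R : realType}.

Lemma sum_mxvec_index m n (F : 'I_(m * n) -> R) :
  \sum_q F q = \sum_i \sum_j F (mxvec_index i j).
Proof.
rewrite (reindex _ (curry_mxvec_bij _ _)) pair_bigA.
by apply: eq_bigr => -[i j].
Qed.

Lemma lin_mx_entry m n (f : 'M[R]_(m, n) -> 'M[R]_(m, n)) i j i' j' :
  (lin_mx f)^T (mxvec_index i j) (mxvec_index i' j') = f (delta_mx i' j') i j.
Proof. by rewrite !mxE /= vec_mx_delta mxvecE. Qed.

Lemma mul_delta_mx_entry m n p (M : 'M[R]_(m, n)) i' (j' : 'I_p) i j :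
  (M *m delta_mx i' j') i j = M i i' *+ (j == j').
Proof.
rewrite mxE (bigD1 i')//= mxE eqxx big1 ?addr0 => [|l /negPf li]; last first.
  by rewrite mxE li mulr0.
by case: eqP; rewrite ?mulr1 ?mulr0.
Qed.

Lemma delta_mx_mul_entry m n p (M : 'M[R]_(n, p)) (i' : 'I_m) j' i j :
  (delta_mx i' j' *m M) i j = M j' j *+ (i == i').
Proof.
rewrite mxE (bigD1 j')//= mxE eqxx andbT big1 ?addr0 => [|l /negPf lj].
  by case: eqP; rewrite ?mul1r ?mul0r.
by rewrite mxE lj andbF mul0r.
Qed.

(** T acts within each column of the grid: row (i, j) holds row i of T at the positions (i', j) and
    zeros elsewhere. *)
Lemma dominant_lin_mulmx m n (T : 'M[R]_m) :
  dominant T -> dominant (@lin_mulmx R m m n T)^T.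
Proof.
case=> symT offT rowT; split.
- apply/matrixP; case/mxvec_indexP => i j; case/mxvec_indexP => i' j'.
  rewrite mxE !lin_mx_entry !mul_delta_mx_entry eq_sym.
  by rewrite -[in LHS]symT mxE.
- case/mxvec_indexP => i j; case/mxvec_indexP => i' j' ne.
  rewrite lin_mx_entry mul_delta_mx_entry; case: eqP => // jj.
  by apply: offT; apply: contra ne => /eqP ->; rewrite jj.
- case/mxvec_indexP => i j; rewrite sum_mxvec_index.
  rewrite (eq_bigr (T i)); first exact: rowT.
  move=> i' _; rewrite (bigD1 j)//= big1 => [|j' /negPf jj].
    by rewrite lin_mx_entry mul_delta_mx_entry eqxx addr0.
  by rewrite lin_mx_entry mul_delta_mx_entry eq_sym jj.
Qed.

(** Multiplication on the right picks up columns of T, which symmetry turns back into rows. *)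
Lemma dominant_lin_mulmxr m n (T : 'M[R]_n) :
  dominant T -> dominant (@lin_mulmxr R m n n T)^T.
Proof.
case=> symT offT rowT; have symE i j : T i j = T j i by rewrite -[in LHS]symT mxE.
split.
- apply/matrixP; case/mxvec_indexP => i j; case/mxvec_indexP => i' j'.
  by rewrite mxE !lin_mx_entry /= !delta_mx_mul_entry eq_sym symE.
- case/mxvec_indexP => i j; case/mxvec_indexP => i' j' ne.
  rewrite lin_mx_entry /= delta_mx_mul_entry; case: eqP => // ii.
  by apply: offT; apply: contra ne => /eqP ->; rewrite ii.
- case/mxvec_indexP => i j; rewrite sum_mxvec_index exchange_big /=.
  rewrite (eq_bigr (T j)); first exact: rowT.
  move=> j' _; rewrite (bigD1 i)//= big1 => [|i' /negPf ii].
    by rewrite lin_mx_entry /= delta_mx_mul_entry eqxx addr0 symE.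
  by rewrite lin_mx_entry /= delta_mx_mul_entry eq_sym ii.
Qed.

End kronecker.

Definition riesz_mx (R : realType) (nu : R) n : 'M[R]_n :=
  \matrix_(i, j) - gtilde nu i j.

Lemma dominant_riesz_mx (R : realType) (nu : R) n : 1 < nu < 2 ->
  dominant (riesz_mx nu n).
Proof.
move=> nuP; split=> [|i j ij|i].
- by apply/matrixP => i j; rewrite !mxE gtilde_sym.
- by rewrite mxE oppr_le0 gtilde_ge0.
- rewrite (eq_bigr (fun j : 'I_n => - gtilde nu i j)) => [|j _]; last by rewrite mxE.
  by rewrite sumrN oppr_gt0 gtilde_row_lt0.
Qed.

Section grid.
Context {R : realType} (G : mesh R).

Definition xweight (alpha : R) (c : R -> R -> R -> R) k :
    'M[R]_(Nx G - 1, Ny G - 1) :=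
  \matrix_(i, j) (- (dt G * kappa alpha * at_node G c k i j)
    / (2 * Gamma (4 - alpha) * dx G `^ alpha)).

Definition yweight (beta : R) (d : R -> R -> R -> R) k :
    'M[R]_(Nx G - 1, Ny G - 1) :=
  \matrix_(i, j) (- (dt G * kappa beta * at_node G d k i j)
    / (2 * Gamma (4 - beta) * dy G `^ beta)).

Lemma AxE alpha c k : Ax G alpha c k =
  - (diag_mx (mxvec (xweight alpha c k)) *m
     (@lin_mulmx R _ _ (Ny G - 1) (riesz_mx alpha (Nx G - 1)))^T).
Proof.
apply/matrixP; case/mxvec_indexP => i j; case/mxvec_indexP => i' j'.
rewrite /Ax lin_mx_entry [RHS]mxE mul_diag_mx [X in - X]mxE mxvecE lin_mx_entry.
rewrite [LHS]mxE [xweight _ _ _ _ _]mxE -[RHS]mulrN; congr (_ * _).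
rewrite mxE -sumrN; apply: eq_bigr => m _.
by rewrite [riesz_mx _ _ _ _]mxE mulNr opprK.
Qed.

Lemma AyE beta d k : Ay G beta d k =
  - (diag_mx (mxvec (yweight beta d k)) *m
     (@lin_mulmxr R (Nx G - 1) _ _ (riesz_mx beta (Ny G - 1)))^T).
Proof.
apply/matrixP; case/mxvec_indexP => i j; case/mxvec_indexP => i' j'.
rewrite /Ay lin_mx_entry [RHS]mxE mul_diag_mx [X in - X]mxE mxvecE lin_mx_entry.
rewrite [LHS]mxE [yweight _ _ _ _ _]mxE -[RHS]mulrN; congr (_ * _).
rewrite mxE -sumrN; apply: eq_bigr => m _.
by rewrite [riesz_mx _ _ _ _]mxE mulrN opprK gtilde_sym mulrC.
Qed.

Lemma dx_gt0 : xL G < xR G -> (0 < Nx G)%N -> 0 < dx G.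
Proof. by move=> hx hN; rewrite divr_gt0 ?subr_gt0 ?ltr0n. Qed.

Lemma dy_gt0 : yL G < yR G -> (0 < Ny G)%N -> 0 < dy G.
Proof. by move=> hy hN; rewrite divr_gt0 ?subr_gt0 ?ltr0n. Qed.

Lemma xpt_bounds (i : 'I_(Nx G - 1)) : xL G < xR G -> (0 < Nx G)%N ->
  xL G < xpt G i.+1 < xR G.
Proof.
move=> hx hN; have N0 : 0 < (Nx G)%:R :> R by rewrite ltr0n.
rewrite /xpt ltrDl mulr_gt0 ?dx_gt0//= -ltrBrDl /dx mulrA ltr_pdivrMr//.
by rewrite mulrC ltr_pM2l ?subr_gt0// ltr_nat; have := ltn_ord i; lia.
Qed.

Lemma ypt_bounds (j : 'I_(Ny G - 1)) : yL G < yR G -> (0 < Ny G)%N ->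
  yL G < ypt G j.+1 < yR G.
Proof.
move=> hy hN; have N0 : 0 < (Ny G)%:R :> R by rewrite ltr0n.
rewrite /ypt ltrDl mulr_gt0 ?dy_gt0//= -ltrBrDl /dy mulrA ltr_pdivrMr//.
by rewrite mulrC ltr_pM2l ?subr_gt0// ltr_nat; have := ltn_ord j; lia.
Qed.

Lemma thalf_bounds k : 0 < Tmax G -> (k < Nt G)%N -> 0 < thalf G k <= Tmax G.
Proof.
move=> hT kN; have N0 : 0 < (Nt G)%:R :> R by rewrite ltr0n; lia.
have kN' : k%:R + 1 <= (Nt G)%:R :> R by rewrite natr1 ler_nat.
have dt0 : 0 < dt G by rewrite divr_gt0.
have TE : Tmax G = (Nt G)%:R * dt G by rewrite /dt mulrC divfK// gt_eqF.
have k0 : 0 <= k%:R :> R by [].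
by rewrite /thalf /tpt TE -natr1; apply/andP; split; nra.
Qed.

End grid.

(** The minus sign cancels against the negative [kappa], so the diagonal weights take the sign of
    the coefficient. *)
Lemma weight_pos (R : realType) (nu tau h : R) : 1 < nu < 2 -> 0 < tau -> 0 < h ->
  exists2 w, 0 < w & forall c,
    - (tau * kappa nu * c) / (2 * Gamma (4 - nu) * h `^ nu) = w * c.
Proof.
move=> nuP tau0 h0; have k0 := kappa_lt0 nuP.
have G0 : 0 < Gamma (4 - nu) by apply: Gamma_gt0; move/andP: nuP => [? ?]; lra.
exists (- (tau * kappa nu) / (2 * Gamma (4 - nu) * h `^ nu)) => [|c].
  by rewrite divr_gt0 ?mulr_gt0 ?powR_gt0// oppr_gt0 pmulr_rlt0.
by rewrite -mulNr [RHS]mulrAC.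
Qed.

Unset Implicit Arguments.


Theorem theorem3p3 (R : realType) (alpha beta : R) (G : mesh R)
    (c d : R -> R -> R -> R) (k : nat)
    (halpha : 1 < alpha < 2) (hbeta : 1 < beta < 2)
    (hx : xL G < xR G) (hy : yL G < yR G) (hT : 0 < Tmax G)
    (hNx : (0 < Nx G)%N) (hNy : (0 < Ny G)%N) (hk : (k < Nt G)%N)
    (hc : forall x y t : R, xL G < x < xR G -> yL G < y < yR G ->
            0 < t <= Tmax G -> 0 <= c x y t)
    (hd : forall x y t : R, xL G < x < xR G -> yL G < y < yR G ->
            0 < t <= Tmax G -> 0 <= d x y t)
    (hcomm : comm_mx (Ax G alpha c k) (Ay G beta d k)) :
  let A := Ax G alpha c k in
  let B := Ay G beta d k in
  (weakly_stable A B (D_AD A B (dt G)) /\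
   weakly_stable A B (PR_AD A B (dt G))) /\
  ((forall (i : 'I_(Nx G - 1)) (j : 'I_(Ny G - 1)), 0 < at_node G c k i j) ->
   (forall (i : 'I_(Nx G - 1)) (j : 'I_(Ny G - 1)), 0 < at_node G d k i j) ->
   stable A B (D_AD A B (dt G)) /\ stable A B (PR_AD A B (dt G))).
Proof.
move=> A B; have dt0 : 0 < dt G by rewrite divr_gt0// ltr0n (leq_trans _ hk).
have [wx wx0 wxE] := weight_pos halpha dt0 (dx_gt0 hx hNx).
have [wy wy0 wyE] := weight_pos hbeta dt0 (dy_gt0 hy hNy).
have tb := thalf_bounds hT hk.
have domx := dominant_lin_mulmx (Ny G - 1) (dominant_riesz_mx (Nx G - 1) halpha).
have domy := dominant_lin_mulmxr (Nx G - 1) (dominant_riesz_mx (Ny G - 1) hbeta).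
(* [hc] applies only inside the domain, where the interior nodes and the half time level lie. *)
have Dx0 q : 0 <= mxvec (xweight G alpha c k) 0 q.
  case/mxvec_indexP: q => i j; rewrite mxvecE mxE wxE mulr_ge0 ?(ltW wx0)//.
  exact: hc (xpt_bounds i hx hNx) (ypt_bounds j hy hNy) tb.
have Dy0 q : 0 <= mxvec (yweight G beta d k) 0 q.
  case/mxvec_indexP: q => i j; rewrite mxvecE mxE wyE mulr_ge0 ?(ltW wy0)//.
  exact: hd (xpt_bounds i hx hNx) (ypt_bounds j hy hNy) tb.
move: hcomm; rewrite /A /B AxE AyE => AB.
have uA := sub1_unitmx domx Dx0; have uB := sub1_unitmx domy Dy0.
have wpD := D_AD_well_posed (dt G) uA uB.
have wpPR := PR_AD_well_posed (dt G) uA uB.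
have prD := factored_propagates (@D_AD_factored _ _ _ _ (dt G)).
have prPR := factored_propagates (@PR_AD_factored _ _ _ _ (dt G)).
split; first by split; exact: dominant_weakly_stable.
move=> c0 d0.
have Dx_gt0 q : 0 < mxvec (xweight G alpha c k) 0 q.
  by case/mxvec_indexP: q => i j; rewrite mxvecE mxE wxE mulr_gt0.
have Dy_gt0 q : 0 < mxvec (yweight G beta d k) 0 q.
  by case/mxvec_indexP: q => i j; rewrite mxvecE mxE wyE mulr_gt0.
by split; exact: dominant_stable.
Qed.
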